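(* Let $(V,g)$ be a Euclidean real vector space of dimension $n$ and let $h$ be a bilinear form on $V$. For each $k$ with $0\le k\le n-1$, $$(k+1)\,s_{k+1}(h)=\langle t_k(h),h\rangle,$$ where $\langle\cdot,\cdot\rangle$ is the standard inner product of bilinear forms, $s_{k}(h)$ are the characteristic coefficients of $h$ and $t_k(h)=\frac{1}{k!\,(n-1-k)!}*\bigl(g^{n-1-k}h^k\bigr)$.
   Context: Let $(V,g)$ be a Euclidean real vector space of dimension $n$. A $(p,q)$ double form is an element of $\mathcal D^{p,q}=\Lambda^pV^*\otimes\Lambda^qV^*$, identified with a bilinear form $\Lambda^pV\times\Lambda^qV\to\mathbb R$. Exterior product: $(\theta_1\otimes\theta_2)(\theta_3\otimes\theta_4)=(\theta_1\wedge\theta_3)\otimes(\theta_2\wedge\theta_4)$, extended bilinearly; products and powers in the claim are exterior products, with zeroth power $1$; bilinear forms such as $g,h$ are regarded as $(1,1)$ double forms. Double Hodge star: for a $(p,p)$ double form $\omega$, $*\omega$ is the $(n-p,n-p)$ double form $*\omega(u,v)=\omega( *u,*v)$, with $*$ on the right the usual Hodge star $\Lambda^{n-p}V\to\Lambda^{p}V$ for some chosen orientation (the result does not depend on it). The inner product of bilinear forms is $\langle a,b\rangle=\sum_{i,j}a(e_i,e_j)b(e_i,e_j)$ for any orthonormal basis $(e_i)$. The invariants $s_k(h)$, $0\le k\le n$, are defined by $\det(\bar h-\lambda I)=\sum_{k=0}^n(-1)^{n-k}s_k(h)\lambda^{n-k}$, where $\bar h$ is the linear operator on $V$ corresponding to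 $h$ via $g$ (with matrix $(h(e_i,e_j))$, up to transposition, in an orthonormal basis); $s_0(h)=1$, $s_1$ is the trace, $s_n$ the determinant. *)

(* Defs.v *)
From HB Require Import structures.
From mathcomp Require Import all_boot all_order all_algebra.
From mathcomp Require Import reals.

Set Implicit Arguments.
Unset Strict Implicit.
Unset Printing Implicit Defensive.

Import Order.TTheory GRing.Theory Num.Theory.
Local Open Scope ring_scope.

(* The exterior algebra of an n-dimensional space with a chosen (ordered)     *)
(* basis e is the free module on the monomials                                *)
(*   e_S = e_(i_1) /\ ... /\ e_(i_p),  S = {i_1 < ... < i_p};                 *)
(* an element is the family of its coefficients on the e_S, and the grade p   *)
(* part is spanned by the e_S with #|S| = p.  The exterior algebra of the     *)
(* dual space is represented in the same way, on the dual basis.              *)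
Notation extalg R n := {ffun {set 'I_n} -> R^o}.

(* Lambda V^* (x) Lambda V^*: the coefficient at (S, T) is that of            *)
(* e^S (x) e^T; the (p, q) double forms are those supported on the (S, T)     *)
(* with #|S| = p and #|T| = q.                                                *)
Notation dform R n := {ffun {set 'I_n} * {set 'I_n} -> R^o}.

Section DoubleForms.
Variables (R : comNzRingType) (n : nat).
Implicit Types (S T : {set 'I_n}) (a b u v : extalg R n) (w : dform R n).

Definition emon S : extalg R n := [ffun T => (T == S)%:R].

(* e_S /\ e_T = wsign S T * e_(S :|: T): the exponent counts the inversions   *)
(* of the concatenation of S and T, each listed increasingly.                 *)
Definition wsign S T : R :=
  if [disjoint S & T]
  then (-1) ^+ #|[set ij : 'I_n * 'I_n |
                  [&& ij.1 \in S, ij.2 \in T & (ij.2 < ij.1)%N]]|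
  else 0.

Definition wedge a b : extalg R n :=
  \sum_S \sum_T (a S * b T * wsign S T : R) *: emon (S :|: T).

(* Hodge star for which (e_i) is orthonormal and positively oriented. *)
Definition hodge a : extalg R n :=
  \sum_S (a S * wsign S (~: S) : R) *: emon (~: S).

Definition tens a b : dform R n := [ffun ST => a ST.1 * b ST.2].

(* w as a bilinear form on multivectors *)
Definition deval w u v : R := \sum_S \sum_T w (S, T) * u S * v T.

(* bilinear extension of                                                      *)
(*  (e^S (x) e^T) (e^S' (x) e^T') = (e^S /\ e^S') (x) (e^T /\ e^T')           *)
Definition dmul (w1 w2 : dform R n) : dform R n :=
  \sum_(ST : {set 'I_n} * {set 'I_n}) \sum_(UW : {set 'I_n} * {set 'I_n})
    (w1 ST * w2 UW : R) *: tens (wedge (emon ST.1) (emon UW.1))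
                                (wedge (emon ST.2) (emon UW.2)).

Definition dform1 : dform R n := tens (emon set0) (emon set0).

Definition dpow w (k : nat) : dform R n := iter k (dmul w) dform1.

(* given by its values on the basis multivectors; see deval_dstar *)
Definition dstar w : dform R n :=
  [ffun ST => deval w (hodge (emon ST.1)) (hodge (emon ST.2))].

Lemma sum_emon (F : {set 'I_n} -> R) S : \sum_T (emon S T : R) * F T = F S.
Proof.
rewrite (bigD1 S) //= ffunE eqxx mul1r big1 ?addr0 // => T /negPf nTS.
by rewrite ffunE nTS mul0r.
Qed.

Lemma emon_wedge S T X : wedge (emon S) (emon T) X = wsign S T * emon (S :|: T) X.
Proof.
rewrite -(sum_emon (fun S => wsign S T * emon (S :|: T) X) S) /wedge sum_ffunE.
apply: eq_bigr => U _; rewrite sum_ffunE.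
rewrite -(sum_emon (fun T => wsign U T * emon (U :|: T) X) T) mulr_sumr.
by apply: eq_bigr => W _; rewrite [LHS]ffunE /GRing.scale /= -!mulrA.
Qed.

Lemma emon_hodge S X : hodge (emon S) X = wsign S (~: S) * emon (~: S) X.
Proof.
rewrite -(sum_emon (fun S => wsign S (~: S) * emon (~: S) X) S) /hodge sum_ffunE.
by apply: eq_bigr => U _; rewrite [LHS]ffunE /GRing.scale /= -!mulrA.
Qed.

Lemma wedgeE a b X :
  wedge a b X = \sum_S \sum_T a S * b T * wedge (emon S) (emon T) X.
Proof.
rewrite /wedge sum_ffunE; apply: eq_bigr => S _; rewrite sum_ffunE.
apply: eq_bigr => T _; rewrite -/(wedge (emon S) (emon T)) emon_wedge.
by rewrite [LHS]ffunE /GRing.scale /= -!mulrA.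
Qed.

Lemma hodgeE a X : hodge a X = \sum_S a S * hodge (emon S) X.
Proof.
rewrite /hodge sum_ffunE; apply: eq_bigr => S _.
by rewrite -/(hodge (emon S)) emon_hodge [LHS]ffunE /GRing.scale /= -!mulrA.
Qed.

(* a /\ *b = <a, b> e_1 /\ ... /\ e_n on basis multivectors of equal degree *)
Lemma wedge_hodge S T : #|S| = #|T| ->
  wedge (emon S) (hodge (emon T)) = ((S == T)%:R : R) *: emon setT.
Proof.
move=> cST; apply/ffunP => X; rewrite wedgeE [RHS]ffunE /GRing.scale /=.
pose F U W : R := hodge (emon T) W * wedge (emon U) (emon W) X.
transitivity (\sum_W F S W).
  rewrite -(sum_emon (fun S => \sum_W F S W)); apply: eq_bigr => U _.
  by rewrite mulr_sumr; apply: eq_bigr => W _; rewrite /F -mulrA.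
transitivity (wsign T (~: T) * wedge (emon S) (emon (~: T)) X).
  rewrite -(sum_emon (fun W => wsign T (~: T) * wedge (emon S) (emon W) X)).
  apply: eq_bigr => W _; rewrite /F emon_hodge !mulrA.
  by congr (_ * _); rewrite mulrC.
rewrite emon_wedge.
have [<-|nST] := eqVneq S T; last first.
  suff -> : wsign S (~: T) = 0 by rewrite !mul0r mulr0.
  rewrite /wsign disjoints_subset setCK ifN //.
  by apply: contraNN nST => sST; rewrite eqEcard sST cST leqnn.
rewrite mul1r mulrA setUCr /wsign disjoints_subset setCK subxx.
by rewrite -exprD addnn -mul2n exprM sqrrN expr1n expr1n mul1r.
Qed.

Lemma dmul_tens a b c d :
  dmul (tens a b) (tens c d) = tens (wedge a c) (wedge b d).
Proof.
apply/ffunP => -[X Y]; rewrite [RHS]ffunE /= /dmul sum_ffunE.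
rewrite [X in X * _]wedgeE [X in _ * X]wedgeE big_distrlr /= pair_bigA /=.
apply: eq_bigr => -[S T] _ /=; rewrite sum_ffunE big_distrlr /= pair_bigA /=.
apply: eq_bigr => -[U W] _ /=; rewrite [LHS]ffunE /GRing.scale /= !ffunE /=.
by rewrite [RHS]mulrACA; congr (_ * _); rewrite mulrACA.
Qed.

Lemma deval_dstar w u v : deval (dstar w) u v = deval w (hodge u) (hodge v).
Proof.
rewrite {2}/deval.
transitivity (\sum_S \sum_T \sum_X \sum_Y
   w (X, Y) * (u S * hodge (emon S) X) * (v T * hodge (emon T) Y)).
  apply: eq_bigr => S _; apply: eq_bigr => T _; rewrite ffunE /= /deval.
  rewrite !mulr_suml; apply: eq_bigr => X _; rewrite !mulr_suml.
  apply: eq_bigr => Y _; rewrite [u S * _]mulrC [v T * _]mulrC !mulrA.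
  by congr (_ * _); rewrite -!mulrA; do 2 congr (_ * _); rewrite mulrC.
under eq_bigr do rewrite exchange_big /=.
rewrite exchange_big /=; apply: eq_bigr => X _.
transitivity (\sum_S \sum_Y \sum_T
   w (X, Y) * (u S * hodge (emon S) X) * (v T * hodge (emon T) Y)).
  by apply: eq_bigr => S _; rewrite exchange_big.
rewrite exchange_big /=; apply: eq_bigr => Y _.
by rewrite (hodgeE u) (hodgeE v) [w (X, Y) * _]mulr_sumr big_distrlr.
Qed.

End DoubleForms.

Section EuclideanSpace.
Variables (R : realType) (V : vectType R) (n : nat) (e : n.-tuple V).

Definition orthonormal_basis (g : {dot V for idfun}) : Prop :=
  basis_of fullv e /\ forall i j : 'I_n, g e`_i e`_j = (i == j)%:R.

Definition ext1 (v : V) : extalg R n :=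
  \sum_(i < n) coord e i v *: emon R [set i].

Definition dform_of_bil (b : V -> V -> R) : dform R n :=
  \sum_(i < n) \sum_(j < n)
    b e`_i e`_j *: tens (emon R [set i]) (emon R [set j]).

Definition bil_of_dform (w : dform R n) (u v : V) : R :=
  deval w (ext1 u) (ext1 v).

Definition bil_inner (a b : V -> V -> R) : R :=
  \sum_(i < n) \sum_(j < n) a e`_i e`_j * b e`_i e`_j.

Definition bil_mx (h : V -> V -> R) : 'M[R]_n := \matrix_(i, j) h e`_i e`_j.

(* det (h - X I) = \sum_(k <= n) (-1)^(n-k) s_k(h) X^(n-k) *)
Definition char_inv (k : nat) (h : V -> V -> R) : R :=
  (-1) ^+ (n - k) * (\det (map_mx polyC (bil_mx h) - 'X%:M))`_(n - k).

Definition newton_transf (g : V -> V -> R) (k : nat) (h : V -> V -> R) :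
    V -> V -> R :=
  bil_of_dform (((k`! * (n - 1 - k)`!)%:R^-1 : R) *:
    dstar (dmul (dpow (dform_of_bil g) (n - 1 - k)) (dpow (dform_of_bil h) k))).

End EuclideanSpace.

(* Main.v *)
From HB Require Import structures.
Require Import Defs.
From mathcomp Require Import all_boot all_order all_algebra all_fingroup.
From mathcomp Require Import reals.

Set Implicit Arguments.
Unset Strict Implicit.
Unset Printing Implicit Defensive.

Import GRing.Theory Num.Theory.
Local Open Scope ring_scope.

(** The double forms are an associative algebra in which bilinear forms commute
    with each other. Expanding the [n]-th power of a bilinear form with matrix
    [A] and collecting signs shows that its top coefficient is [n! det A].
    Applied to [h - x g], where the binomial formula holds, this identifies the
    top coefficient of [g^(n-k-1) h^(k+1)] with
    [(n-k-1)! (k+1)! s_(k+1)(h)], by comparing powers of [x]. Finally, the sum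
    [<*w, h>] is the top coefficient of [h w] for an [(n-1, n-1)] form [w]: the
    signs of [e_i /\ e_(~i)] are those of the Hodge star. *)

(** * Bilinear products on a free module given by structure constants *)

Section BilinearExtension.
Variables (R : comNzRingType) (I : finType).
Local Notation V := {ffun I -> R^o}.
Variable c : I -> I -> V.
Implicit Types a b : V.

Definition delta i : V := [ffun j => (j == i)%:R].

Definition bmul a b : V := \sum_i \sum_j (a i * b j : R) *: c i j.

Lemma ffun_sum_delta a : a = \sum_i (a i : R) *: delta i.
Proof.
apply/ffunP => j; rewrite sum_ffunE (bigD1 j) //= big1 => [|i /negPf nij].
  by rewrite addr0 !ffunE eqxx; exact/esym/mulr1.
by rewrite !ffunE eq_sym nij; exact: mulr0.
Qed.

Lemma bmulDl : left_distributive bmul +%R.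
Proof.
move=> a a' b; rewrite /bmul -big_split; apply: eq_bigr => i _.
rewrite -big_split; apply: eq_bigr => j _.
by rewrite ffunE mulrDl scalerDl.
Qed.

Lemma bmulDr : right_distributive bmul +%R.
Proof.
move=> a b b'; rewrite /bmul -big_split; apply: eq_bigr => i _.
rewrite -big_split; apply: eq_bigr => j _.
by rewrite ffunE mulrDr scalerDl.
Qed.

Lemma bmulZl x a b : bmul (x *: a) b = x *: bmul a b.
Proof.
rewrite /bmul scaler_sumr; apply: eq_bigr => i _.
rewrite scaler_sumr; apply: eq_bigr => j _.
by rewrite ffunE scalerA; congr (_ *: _); rewrite mulrA.
Qed.

Lemma bmulZr x a b : bmul a (x *: b) = x *: bmul a b.
Proof.
rewrite /bmul scaler_sumr; apply: eq_bigr => i _.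
rewrite scaler_sumr; apply: eq_bigr => j _.
by rewrite ffunE scalerA; congr (_ *: _); rewrite mulrCA.
Qed.

Lemma bmul0l b : bmul 0 b = 0.
Proof. by have := bmulZl 0 0 b; rewrite !scale0r. Qed.

Lemma bmul0r a : bmul a 0 = 0.
Proof. by have := bmulZr 0 a 0; rewrite !scale0r. Qed.

Lemma bmul_suml J (r : seq J) (F : J -> V) b :
  bmul (\sum_(j <- r) F j) b = \sum_(j <- r) bmul (F j) b.
Proof.
by apply: (big_morph (bmul^~ b) (fun x y => bmulDl x y b) (bmul0l b)).
Qed.

Lemma bmul_sumr J (r : seq J) (F : J -> V) a :
  bmul a (\sum_(j <- r) F j) = \sum_(j <- r) bmul a (F j).
Proof. exact: (big_morph (bmul a) (bmulDr a) (bmul0r a)). Qed.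

Lemma bmul_delta i j : bmul (delta i) (delta j) = c i j.
Proof.
rewrite /bmul (bigD1 i) //= (bigD1 j) //= !ffunE !eqxx mulr1 scale1r.
rewrite !big1 ?addr0 // => [i' /negPf ni|j' /negPf nj].
  by rewrite big1 // => j' _; rewrite ffunE ni mul0r scale0r.
by rewrite ffunE nj mulr0 scale0r.
Qed.

Lemma bmul_expandl a b : bmul a b = \sum_i (a i : R) *: bmul (delta i) b.
Proof.
rewrite {1}(ffun_sum_delta a) bmul_suml.
by apply: eq_bigr => i _; rewrite bmulZl.
Qed.

Lemma bmul_expandr a b : bmul a b = \sum_i (b i : R) *: bmul a (delta i).
Proof.
rewrite {1}(ffun_sum_delta b) bmul_sumr.
by apply: eq_bigr => i _; rewrite bmulZr.
Qed.

(** Both sides are trilinear, so it suffices to compare them on basis vectors; [c j k] stands for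
    the product of [delta j] and [delta k]. *)
Lemma bmulA :
    (forall i j k, bmul (delta i) (c j k) = bmul (c i j) (delta k)) ->
  associative bmul.
Proof.
move=> cA x y z; rewrite (bmul_expandl x y) bmul_suml bmul_expandl.
apply: eq_bigr => i _; rewrite bmulZl; congr (_ *: _).
rewrite (bmul_expandr _ y) (bmul_expandl y z) bmul_suml bmul_sumr.
apply: eq_bigr => j _; rewrite bmulZl bmulZr; congr (_ *: _).
rewrite (bmul_expandr _ z) [RHS]bmul_expandr bmul_sumr.
by apply: eq_bigr => k _; rewrite bmulZr !bmul_delta cA.
Qed.

Lemma bmul1l i0 : (forall i, c i0 i = delta i) -> left_id (delta i0) bmul.
Proof.
move=> c1 a; rewrite (ffun_sum_delta a) bmul_sumr.
by apply: eq_bigr => i _; rewrite bmulZr bmul_delta c1.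
Qed.

Lemma bmul1r i0 : (forall i, c i i0 = delta i) -> right_id (delta i0) bmul.
Proof.
move=> c1 a; rewrite (ffun_sum_delta a) bmul_suml.
by apply: eq_bigr => i _; rewrite bmulZl bmul_delta c1.
Qed.

End BilinearExtension.

(** * Associativity of the exterior product and of the product of double forms *)

Section ExteriorAlgebra.
Variables (R : comNzRingType) (n : nat).
Implicit Types (S T U : {set 'I_n}).

Definition inversions S T :=
  #|[set ij : 'I_n * 'I_n | [&& ij.1 \in S, ij.2 \in T & (ij.2 < ij.1)%N]]|.

Lemma wsignE S T :
  wsign R S T = if [disjoint S & T] then (-1) ^+ inversions S T else 0.
Proof. by []. Qed.

(** An inversion has its first index in exactly one of [S] and [T], so the two counts do not
    overlap. *)
Lemma inversionsUl S T U : [disjoint S & T] ->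
  inversions (S :|: T) U = (inversions S U + inversions T U)%N.
Proof.
move=> dST; rewrite /inversions -cardsUI.
rewrite [X in _ = (_ + X)%N]eq_card0 => [|[i j]]; last first.
  rewrite !inE /=; case: (boolP (i \in S)) => //= iS.
  by rewrite (disjointFr dST iS) /= andbF.
by rewrite addn0; apply: eq_card => -[i j]; rewrite !inE /= -andb_orl.
Qed.

Lemma inversionsUr S T U : [disjoint T & U] ->
  inversions S (T :|: U) = (inversions S T + inversions S U)%N.
Proof.
move=> dTU; rewrite /inversions -cardsUI.
rewrite [X in _ = (_ + X)%N]eq_card0 => [|[i j]]; last first.
  rewrite !inE /=; case: (boolP (j \in T)) => jT.
    by rewrite (disjointFr dTU jT) /= !andbF.
  by rewrite andbF.
by rewrite addn0; apply: eq_card => -[i j]; rewrite !inE /= -andb_orr andb_orl.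
Qed.


(** This is associativity of the exterior product on monomials. Both sides vanish unless the three
    sets are pairwise disjoint, and then both exponents add up the inversions of the pairs [(S, T)],
    [(S, U)] and [(T, U)]. *)
Lemma wsign_cocycle S T U :
  wsign R T U * wsign R S (T :|: U) = wsign R S T * wsign R (S :|: T) U.
Proof.
rewrite !wsignE.
have dUl (A B C : {set 'I_n}) :
    [disjoint A :|: B & C] = [disjoint A & C] && [disjoint B & C].
  by rewrite -!setI_eq0 setIUl setU_eq0.
rewrite dUl (disjoint_sym S (T :|: U)) dUl !(disjoint_sym _ S).
case dST: [disjoint S & T]; last by rewrite mulr0 mul0r.
case dTU: [disjoint T & U]; last by rewrite andbF mulr0 mul0r.
case dSU: [disjoint S & U]; last by rewrite !mulr0.
by rewrite inversionsUl ?inversionsUr // -!exprD [in LHS]addnC addnA.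
Qed.

Definition wedge_emon S T : {ffun {set 'I_n} -> R^o} :=
  wsign R S T *: emon R (S :|: T).

Lemma wedge_bmul : @wedge R n =2 bmul wedge_emon.
Proof.
move=> a b; apply: eq_bigr => S _; apply: eq_bigr => T _.
by rewrite /wedge_emon scalerA.
Qed.

Lemma wsign0l S : wsign R set0 S = 1.
Proof.
rewrite wsignE disjoints_subset sub0set /inversions.
by rewrite eq_card0 // => ij; rewrite !inE.
Qed.

Lemma wsign0r S : wsign R S set0 = 1.
Proof.
rewrite wsignE disjoint_sym disjoints_subset sub0set /inversions.
by rewrite eq_card0 // => ij; rewrite !inE andbF.
Qed.

Lemma wedgeA : associative (@wedge R n).
Proof.
move=> a b c; rewrite !wedge_bmul; apply: bmulA => S T U {a b c}.
rewrite /wedge_emon bmulZl bmulZr -[emon _ _]/(delta _ _) !bmul_delta.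
by rewrite /wedge_emon !scalerA wsign_cocycle setUA.
Qed.

Lemma wedge1l : left_id (emon R set0) (@wedge R n).
Proof.
move=> a; rewrite wedge_bmul; apply: bmul1l => S.
by rewrite /wedge_emon wsign0l scale1r set0U.
Qed.

Lemma wedge1r : right_id (emon R set0) (@wedge R n).
Proof.
move=> a; rewrite wedge_bmul; apply: bmul1r => S.
by rewrite /wedge_emon wsign0r scale1r setU0.
Qed.

Lemma wedgeDl : left_distributive (@wedge R n) +%R.
Proof. by move=> a b c; rewrite !wedge_bmul bmulDl. Qed.

Lemma wedgeDr : right_distributive (@wedge R n) +%R.
Proof. by move=> a b c; rewrite !wedge_bmul bmulDr. Qed.

Definition dmul_emon (P Q : {set 'I_n} * {set 'I_n}) : dform R n :=
  tens (wedge (emon R P.1) (emon R Q.1)) (wedge (emon R P.2) (emon R Q.2)).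

Lemma dmul_bmul : @dmul R n =2 bmul dmul_emon.
Proof. by []. Qed.

Lemma tens_emon S T : tens (emon R S) (emon R T) = delta R (S, T).
Proof.
apply/ffunP => -[S' T']; rewrite !ffunE /= xpair_eqE.
by case: eqP; rewrite ?(mul1r, mul0r).
Qed.

(** On basis forms, [dmul_tens] separates the two tensor factors, and each is an instance of
    [wedgeA]. *)
Lemma dmulA : associative (@dmul R n).
Proof.
move=> a b c; rewrite !dmul_bmul.
apply: bmulA => -[S S'] [T T'] [U U'] {a b c}.
by rewrite -!dmul_bmul -!tens_emon !dmul_tens !wedgeA.
Qed.

Lemma dmul1l : left_id (dform1 R n) (@dmul R n).
Proof.
move=> a; rewrite /dform1 tens_emon dmul_bmul; apply: bmul1l => -[S T].
by rewrite /dmul_emon !wedge1l tens_emon.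
Qed.

Lemma dmul1r : right_id (dform1 R n) (@dmul R n).
Proof.
move=> a; rewrite /dform1 tens_emon dmul_bmul; apply: bmul1r => -[S T].
by rewrite /dmul_emon !wedge1r tens_emon.
Qed.

(* Aliases of the coefficient families: {ffun _ -> R} already carries the
   pointwise product. *)
Definition extring := {ffun {set 'I_n} -> R^o}.
HB.instance Definition _ := GRing.Lmodule.on extring.
HB.instance Definition _ := GRing.Zmodule_isPzRing.Build extring
  wedgeA wedge1l wedge1r wedgeDl wedgeDr.

Definition dring := {ffun {set 'I_n} * {set 'I_n} -> R^o}.
HB.instance Definition _ := GRing.Lmodule.on dring.
HB.instance Definition _ := GRing.Zmodule_isPzRing.Build dring
  dmulA dmul1l dmul1r (bmulDl dmul_emon) (bmulDr dmul_emon).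

Lemma dring_scalerAl x (a b : dring) : x *: (a * b) = (x *: a) * b.
Proof. by rewrite -[RHS]/(bmul _ _ _) bmulZl. Qed.

Lemma dring_scalerAr x (a b : dring) : x *: (a * b) = a * (x *: b).
Proof. by rewrite -[RHS]/(bmul _ _ _) bmulZr. Qed.

End ExteriorAlgebra.

(** * Products of generators and signs of permutations *)

Section Monomials.
Variables (R : comNzRingType) (n : nat).
Implicit Types (S T : {set 'I_n}) (i j : 'I_n) (l : seq 'I_n).

Definition egen i : extring R n := emon R [set i].

Definition eprod l : extring R n := \prod_(i <- l) egen i.

Lemma mul_emon S T :
  (emon R S : extring R n) * emon R T
    = wsign R S T *: (emon R (S :|: T) : extring R n).
Proof. by rewrite [LHS]wedge_bmul bmul_delta. Qed.

Lemma egen_sqr i : egen i * egen i = 0.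
Proof.
by rewrite mul_emon wsignE disjoints1 inE eqxx scale0r.
Qed.

Lemma inversions1 i j : inversions [set i] [set j] = (j < i)%N.
Proof.
rewrite /inversions; case: ltnP => ij.
  apply: etrans (cards1 (i, j)); apply: eq_card => -[i' j'].
  rewrite !inE xpair_eqE /=.
  by case: eqP => //= ->; case: eqP => //= ->; rewrite ij.
rewrite eq_card0 // => -[i' j']; rewrite !inE /=.
by case: eqP => //= ->; case: eqP => //= ->; rewrite ltnNge ij.
Qed.

(** For distinct indices exactly one of the two orders has an inversion; for equal ones both
    products vanish. *)
Lemma egen_anticomm i j : egen i * egen j = - (egen j * egen i).
Proof.
have [->|nij] := eqVneq i j; first by rewrite egen_sqr oppr0.
rewrite !mul_emon setUC !wsignE !disjoints1 !inE (eq_sym j) (negPf nij).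
rewrite -scaleNr !inversions1; congr (_ *: _).
by case: ltngtP nij => [||/val_inj ->]; rewrite ?eqxx ?expr1 ?expr0 ?opprK.
Qed.

Lemma eprod_cat l1 l2 : eprod (l1 ++ l2) = eprod l1 * eprod l2.
Proof. exact: big_cat. Qed.

Lemma eprod_cons i l : eprod (i :: l) = egen i * eprod l.
Proof. exact: big_cons. Qed.

(** Each factor passed by [egen i] costs one sign, even a copy of [egen i], whose square is zero. *)
Lemma egen_eprod i l : egen i * eprod l = (-1) ^+ size l * (eprod l * egen i).
Proof.
elim: l => [|j l IHl]; first by rewrite /eprod big_nil mulr1 !mul1r.
have c : egen j * (-1) ^+ size l = (-1) ^+ size l * egen j.
  exact: commrX (commrN1 _).
rewrite -[size (j :: l)]/(size l).+1 !eprod_cons mulrA egen_anticomm mulNr.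
rewrite -[in LHS]mulrA IHl exprS mulN1r mulNr; congr (- _).
by rewrite [LHS]mulrA c !mulrA.
Qed.

(* Moving both end factors past eprod l costs the same sign on either side. *)
Lemma eprod_ends i j l : eprod (i :: rcons l j) = - eprod (j :: rcons l i).
Proof.
rewrite -!cats1 !eprod_cons !eprod_cat !mulrA (egen_eprod i) (egen_eprod j).
by rewrite {2 4}/eprod !big_seq1 -!mulrA (egen_anticomm i) !mulrN.
Qed.

(** Bracketing the segment between the two exchanged entries reduces the claim to [eprod_ends]. *)
Lemma eprod_swap i j l1 l2 l3 :
  eprod (l1 ++ i :: l2 ++ j :: l3) = - eprod (l1 ++ j :: l2 ++ i :: l3).
Proof.
rewrite -(cat_rcons j l2) -(cat_rcons i l2) -!(cat_cons _ (rcons _ _)).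
by rewrite !eprod_cat (eprod_ends i) mulNr mulrN.
Qed.

(** A repeated generator can be moved, up to sign, next to its other copy, where the square
    vanishes. *)
Lemma eprod_dup l : ~~ uniq l -> eprod l = 0.
Proof.
elim: l => //= i l IHl; rewrite negb_and negbK => /orP[|/IHl E].
  case/splitPr => l1 l2; rewrite eprod_cons eprod_cat eprod_cons mulrA.
  by rewrite egen_eprod -!mulrA (mulrA (egen i)) egen_sqr mul0r !mulr0.
by rewrite eprod_cons E mulr0.
Qed.

(** In a list without repetition the transposition fixes all entries but [i] and [j], so mapping it
    merely exchanges these two. *)
Lemma eprod_map_tperm i j l : i != j -> uniq l -> i \in l -> j \in l ->
  eprod (map (tperm i j) l) = - eprod l.
Proof.
(* Since [tperm i j] is symmetric in [i] and [j], [i] may be taken to come first. *)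
wlog: i j l / exists l1 l2 l3, l = l1 ++ i :: l2 ++ j :: l3.
  move=> IH nij ul il jl.
  case/splitPr: il ul jl => l1 l2 ul; rewrite mem_cat inE.
  rewrite eq_sym (negPf nij) /= => /orP[] jl; last first.
    case/splitPr: jl ul => l0 l3 ul; apply: IH => //.
    - by exists l1, l0, l3.
    - by rewrite mem_cat inE eqxx orbT.
    by rewrite !(mem_cat, inE) eqxx !orbT.
  case/splitPr: jl ul => l0 l1' ul; rewrite tpermC.
  apply: IH => //; first by exists l0, l1', l2; rewrite -catA.
  - by rewrite eq_sym.
  - by rewrite !(mem_cat, inE) eqxx !orbT.
  by rewrite !(mem_cat, inE) eqxx !orbT.
move=> [l1 [l2 [l3 ->]]] nij ul _ _.
have tid l' : i \notin l' -> j \notin l' -> map (tperm i j) l' = l'.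
  move=> il' jl'; rewrite -[RHS]map_id; apply/eq_in_map => x xl' /=.
  by apply: tpermD; [apply: contraNneq il' | apply: contraNneq jl'] => ->.
have pl : perm_eq (l1 ++ i :: l2 ++ j :: l3) (i :: j :: l1 ++ l2 ++ l3).
  rewrite -cat1s perm_catCA perm_cons.
  by rewrite (catA l1 l2 (j :: l3)) -(cat1s j l3) perm_catCA perm_cons catA.
move: ul; rewrite (perm_uniq pl) !cons_uniq in_cons !mem_cat !negb_or.
case/and3P => /and4P[_ il1 il2 il3] /and3P[jl1 jl2 jl3] _.
by rewrite !(map_cat, map_cons) tpermL tpermR !tid //; apply: eprod_swap.
Qed.

(** Induction on a factorization of [s] into transpositions: each changes the sign once, and their
    number has the parity of [s]. *)
Lemma eprod_perm (s : {perm 'I_n}) l :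
  perm_eq l (enum 'I_n) -> eprod (map s l) = (-1) ^+ s *: eprod l.
Proof.
have [ts -> dts] := prod_tpermP s; rewrite odd_perm_prod // signr_odd.
elim: ts l dts => [|t ts IH] l /=.
  move=> _ _; rewrite big_nil scale1r; congr eprod.
  by rewrite -[RHS]map_id; apply: eq_map => i; rewrite perm1.
case/andP=> dt dts pl; rewrite big_cons.
have inl i : i \in l by rewrite (perm_mem pl) mem_enum.
have ul : uniq l by rewrite (perm_uniq pl) enum_uniq.
have pl' : perm_eq (map (tperm t.1 t.2) l) (enum 'I_n).
  apply: uniq_perm; rewrite ?enum_uniq ?map_inj_uniq //; first exact: perm_inj.
  move=> i; rewrite mem_enum -(tpermK t.1 t.2 i).
  by rewrite mem_map ?inl //; exact: perm_inj.
(* Permutations compose from left to right, so the head transposition acts on the list first. *)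
rewrite (_ : map _ l = map (\prod_(t <- ts) tperm t.1 t.2)%g
   (map (tperm t.1 t.2) l)).
  by rewrite IH // eprod_map_tperm // exprS mulN1r scaleNr scalerN.
by rewrite -map_comp; apply: eq_map => i; rewrite permM.
Qed.

(** Prepending an index below all others creates no inversion. *)
Lemma eprod_sorted l : sorted (fun i j : 'I_n => i < j)%N l ->
  eprod l = emon R [set i in l].
Proof.
elim: l => [|i l IHl] pl.
  rewrite (_ : [set i in [::]] = set0); first by rewrite /eprod big_nil.
  by apply/setP => i; rewrite !inE.
have tr : transitive (fun i j : 'I_n => i < j)%N.
  by move=> x y z; apply: ltn_trans.
have /andP[li ll] :
    all (fun j : 'I_n => i < j)%N l && sorted (fun i j : 'I_n => i < j)%N l.
  by move: pl; rewrite /= path_sortedE.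
rewrite eprod_cons IHl // mul_emon wsignE disjoints1 inE.
rewrite ifT; last by apply/negP => /(allP li); rewrite ltnn.
rewrite /inversions eq_card0 => [|[x y]].
  by rewrite scale1r; congr (emon R _); apply/setP => j; rewrite !inE.
rewrite !inE /=; case: eqP => //= ->; case: (boolP (y \in l)) => //= yl.
by rewrite ltnNge (ltnW (allP li y yl)).
Qed.

Lemma eprod_enum : eprod (enum 'I_n) = emon R setT.
Proof.
rewrite eprod_sorted.
  by congr (emon R _); apply/setP => i; rewrite !inE mem_enum.
by have := iota_ltn_sorted 0 n; rewrite -val_enum_ord sorted_map.
Qed.

Lemma eprod_codom (f : 'I_n -> 'I_n) : ~~ injectiveb f ->
  eprod (codom f) = 0.
Proof. exact: eprod_dup. Qed.
End Monomials.

(** * Powers and top coefficients of double forms *)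

Section DoubleFormPowers.
Variables (R : comNzRingType) (n : nat).
Implicit Types (A B : 'M[R]_n) (S T : {set 'I_n}).

Definition bform A : dring R n :=
  \sum_i \sum_j A i j *: (tens (egen R i) (egen R j) : dring R n).

Lemma tensM (a b c d : extring R n) :
  (tens a b : dring R n) * tens c d = tens (a * c) (b * d).
Proof. exact: dmul_tens. Qed.

Lemma tensNN (a b : extring R n) : tens (- a) (- b) = tens a b.
Proof. by apply/ffunP => p; rewrite !ffunE mulrNN. Qed.

Lemma tens_prod (I : Type) (r : seq I) (F G : I -> extring R n) :
  \prod_(i <- r) (tens (F i) (G i) : dring R n)
    = tens (\prod_(i <- r) F i) (\prod_(i <- r) G i).
Proof.
elim: r => [|i r IHr]; first by rewrite !big_nil.
by rewrite !big_cons IHr tensM.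
Qed.

Lemma dring_prodZ (I : Type) (r : seq I) (c : I -> R) (F : I -> dring R n) :
  \prod_(i <- r) (c i *: F i) = (\prod_(i <- r) c i) *: \prod_(i <- r) F i.
Proof.
elim: r => [|i r IHr]; first by rewrite !big_nil scale1r.
by rewrite !big_cons IHr -dring_scalerAl -dring_scalerAr scalerA.
Qed.

Lemma dring_exprZ x (w : dring R n) m : (x *: w) ^+ m = x ^+ m *: w ^+ m.
Proof.
elim: m => [|m IHm]; first by rewrite !expr0 scale1r.
by rewrite !exprS IHm -dring_scalerAl -dring_scalerAr scalerA.
Qed.

Lemma bformDZ A B x : bform (A + x *: B) = bform A + x *: bform B.
Proof.
rewrite /bform scaler_sumr -big_split; apply: eq_bigr => i _.
rewrite scaler_sumr -big_split; apply: eq_bigr => j _.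
by rewrite !mxE scalerDl scalerA.
Qed.

(** Exchanging two generators changes the sign in both tensor factors, and the two signs cancel. *)
Lemma bform_comm A B : GRing.comm (bform A) (bform B).
Proof.
rewrite /bform.
apply: commr_sum => i _; apply: commr_sum => j _; apply: commr_sym.
apply: commr_sum => k _; apply: commr_sum => l _; rewrite /GRing.comm.
rewrite -!dring_scalerAl -!dring_scalerAr !scalerA mulrC !tensM; congr (_ *: _).
by rewrite (egen_anticomm _ i) (egen_anticomm _ j) tensNN.
Qed.

Lemma sum_ffun_perm (F : {ffun 'I_n -> 'I_n} -> R) :
    (forall f : {ffun 'I_n -> 'I_n}, ~~ injectiveb f -> F f = 0) ->
  \sum_f F f = \sum_(s : 'S_n) F (pval s).
Proof.
move=> F0; rewrite (bigID (fun f : {ffun 'I_n -> 'I_n} => injectiveb f)) /=.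
rewrite [X in _ + X]big1 ?addr0 => [|f /F0//].
rewrite (reindex (@pval _)) /=; last first.
  pose in_Sn := insubd (1%g : 'S_n).
  by exists in_Sn => /= f Uf; first apply: val_inj; apply: insubdK.
by apply: eq_bigl => s; rewrite (valP s).
Qed.

(** The Levi-Civita symbol of the values of [f]: the sign of a permutation, and zero if a value
    repeats. *)
Definition esign (f : {ffun 'I_n -> 'I_n}) : R :=
  eprod R (map f (enum 'I_n)) setT.

Lemma esignE f : esign f = (\prod_i egen R (f i)) setT.
Proof. by rewrite /esign /eprod big_map enumT [index_enum _]unlock. Qed.

Lemma esign_perm (s : 'S_n) : esign (pval s) = (-1) ^+ s.
Proof.
rewrite /esign pvalE eprod_perm // eprod_enum !ffunE eqxx.
exact: mulr1.
Qed.

Lemma esign_noninj (f : {ffun 'I_n -> 'I_n}) : ~~ injectiveb f -> esign f = 0.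
Proof. by move=> nf; rewrite /esign (eprod_codom _ nf) ffunE. Qed.

(** The expansion is a double Leibniz sum over pairs of permutations. For each choice of the first,
    the sum over the second is [\det A]. *)
Lemma bform_expn A : (bform A ^+ n) (setT, setT) = n`!%:R * \det A.
Proof.
(* As a product over ['I_n], the power becomes by distributivity a sum over choices of one index
   pair per factor. *)
rewrite -[in X in _ ^+ X](card_ord n) -prodr_const /bform pair_bigA.
rewrite (bigA_distr_bigA (fun _ p => A p.1 p.2 *:
  (tens (egen R p.1) (egen R p.2) : dring R n))) sum_ffunE.
transitivity (\sum_(f1 : {ffun 'I_n -> 'I_n}) \sum_(f2 : {ffun 'I_n -> 'I_n})
   \prod_k A (f1 k) (f2 k) * (esign f1 * esign f2)).
  rewrite pair_bigA.
  (* A choice of index pairs is a pair of index functions, one for each tensor factor. *)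
  rewrite (reindex (fun p : {ffun 'I_n -> 'I_n} * {ffun 'I_n -> 'I_n} =>
     [ffun k => (p.1 k, p.2 k)] : {ffun 'I_n -> 'I_n * 'I_n})) /=; last first.
    exists (fun f : {ffun 'I_n -> 'I_n * 'I_n} =>
             ([ffun k => (f k).1], [ffun k => (f k).2])) => [[f1 f2]|f] _ /=.
      by congr pair; apply/ffunP => k; rewrite !ffunE.
    by apply/ffunP => k; rewrite !ffunE -surjective_pairing.
  apply: eq_bigr => -[f1 f2] _; rewrite dring_prodZ tens_prod !ffunE /=.
  congr (_ * (_ * _)).
  - by apply: eq_bigr => k _; rewrite ffunE.
  - rewrite esignE.
    by under eq_bigr do rewrite ffunE.
  rewrite esignE.
  by under eq_bigr do rewrite ffunE.
rewrite sum_ffun_perm => [|f nf]; last first.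
  by rewrite big1 // => f2 _; rewrite esign_noninj // mul0r mulr0.
transitivity (\sum_(s : 'S_n) \det A); last first.
  by rewrite sumr_const card_Sn mulr_natl.
apply: eq_bigr => s _; rewrite sum_ffun_perm => [|f nf]; last first.
  by rewrite (esign_noninj nf) !mulr0.
(* Replacing the second permutation by [s * t] leaves the sign of [t] and, after relabelling the
   factors by [s], the product of the entries [A k (t k)]. *)
rewrite (reindex_inj (mulgI s)); apply: eq_bigr => t _ /=.
rewrite !esign_perm -signr_addb odd_permM addKb mulrC; congr (_ * _).
rewrite [RHS](reindex_perm s); apply: eq_bigr => k _.
by rewrite !pvalE permM.
Qed.

Lemma tens_emon_mul_top S S' (w : dring R n) :
  ((tens (emon R S) (emon R S') : dring R n) * w) (setT, setT)
    = wsign R S (~: S) * wsign R S' (~: S') * w (~: S, ~: S').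
Proof.
(* Overlapping monomials multiply to zero, and disjoint ones reach [setT] only if they are
   complementary. *)
have top U X : ((emon R U : extring R n) * emon R X) setT
     = wsign R U (~: U) * (X == ~: U)%:R.
  rewrite mul_emon !ffunE; have [->|nX] := eqVneq X (~: U).
    by rewrite setUCr eqxx.
  rewrite [wsign R U X *: _]/(wsign R U X * _) mulr0.
  case: eqVneq => [T|_]; last exact: mulr0.
  rewrite wsignE; case: ifP => dUX; last exact: mul0r.
  case/eqP: nX; apply/eqP; rewrite eqEsubset.
  rewrite -disjoints_subset disjoint_sym dUX /=.
  apply/subsetP => x; rewrite inE => /negPf xU.
  by have := in_setT x; rewrite T inE xU.
rewrite {1}(ffun_sum_delta w) mulr_sumr sum_ffunE.
rewrite (bigD1 (~: S, ~: S')) //= big1 ?addr0 => [|[X X'] nX].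
  rewrite -dring_scalerAr -tens_emon tensM !ffunE /= !top !eqxx !mulr1.
  by rewrite [LHS]mulrC.
rewrite -dring_scalerAr -tens_emon tensM !ffunE /= !top.
move: nX; rewrite xpair_eqE negb_and => /orP[]/negPf->;
  rewrite !(mulr0, mul0r) //.
  exact: mulr0.
exact: mulr0.
Qed.

(** The two signs are those that [hodge] attaches to the basis vectors [i] and [j], so the sum pairs
    [A] with the double star of [w]. *)
Lemma bform_mul_top A w : (bform A * w) (setT, setT) =
  \sum_i \sum_j A i j * (wsign R [set i] (~: [set i])
     * wsign R [set j] (~: [set j]) * w (~: [set i], ~: [set j])).
Proof.
rewrite /bform mulr_suml sum_ffunE; apply: eq_bigr => i _.
rewrite mulr_suml sum_ffunE; apply: eq_bigr => j _.
by rewrite -dring_scalerAl ffunE tens_emon_mul_top.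
Qed.

Lemma dpow_expr (w : dring R n) m : dpow w m = w ^+ m.
Proof. by elim: m => //= m IHm; rewrite exprS -IHm. Qed.

End DoubleFormPowers.

(** * Coefficients of the characteristic polynomial *)

Lemma poly_horner_inj (R : numDomainType) (p q : {poly R}) :
  (forall x, p.[x] = q.[x]) -> p = q.
Proof.
move=> pq; apply/eqP; rewrite -subr_eq0; apply/eqP.
(* In characteristic zero the naturals below the size of [p - q] are distinct roots, too many for a
   nonzero polynomial. *)
apply: (@roots_geq_poly_eq0 _ _ [seq i%:R | i <- iota 0 (size (p - q))]).
- by apply/allP => x _; rewrite rootE hornerD hornerN pq subrr.
- rewrite map_inj_uniq ?iota_uniq // => i j /eqP.
  by rewrite eqr_nat => /eqP.
by rewrite size_map size_iota.
Qed.

Lemma horner_det_subX (R : comNzRingType) (n : nat) (A : 'M[R]_n) x :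
  (\det (map_mx polyC A - 'X%:M)).[x] = \det (A + (- x) *: 1%:M).
Proof.
rewrite -[LHS]/(horner_eval x _) -det_map_mx; congr (\det _).
apply/matrixP => i j; rewrite !mxE /= /horner_eval hornerD hornerN hornerC.
by rewrite hornerMn hornerX mulr_natr mulNrn.
Qed.

(** The top coefficient of the [n]-th power of [bform (A + (- x) *: 1%:M)] is given both by
    [bform_expn] and by the binomial formula. Comparing the coefficients of the [j]-th power of [x]
    and cancelling ['C(n, j)] leaves the two factorials. *)
Lemma coef_det_subX (R : numDomainType) (n : nat) (A : 'M[R]_n) j :
  (j <= n)%N ->
  (j`! * (n - j)`!)%:R * ((-1) ^+ j * (\det (map_mx polyC A - 'X%:M))`_j)
    = (bform A ^+ (n - j) * bform 1%:M ^+ j) (setT, setT).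
Proof.
move=> jn; set P := \det _.
pose c i : R := (bform A ^+ (n - i) * bform 1%:M ^+ i) (setT, setT).
have E : n`!%:R *: P = \poly_(i < n.+1) ((-1) ^+ i * c i *+ 'C(n, i)).
  apply: poly_horner_inj => x.
  rewrite hornerZ horner_det_subX -bform_expn bformDZ horner_poly.
  have cg : GRing.comm (bform A) (- x *: bform 1%:M).
    rewrite /GRing.comm -dring_scalerAl -dring_scalerAr.
    by rewrite (bform_comm A 1%:M).
  rewrite (exprDn_comm _ cg) sum_ffunE; apply: eq_bigr => i _.
  rewrite dring_exprZ -dring_scalerAr ffunMnE ffunE (exprNn x) mulrnAl.
  congr (_ *+ _); exact: mulrAC.
have := congr1 (fun p : {poly R} => p`_j) E.
rewrite coefZ coef_poly ltnS jn -(bin_fact jn) -/(c j) => Ej.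
have C0 : 'C(n, j)%:R != 0 :> R by rewrite pnatr_eq0 -lt0n bin_gt0.
apply: (mulfI C0); rewrite [LHS]mulrA -natrM mulrCA Ej -mulrnAr mulrA.
(* The sign from the power of [- x] cancels the one in the statement. *)
by rewrite -expr2 sqrr_sign mul1r mulr_natl.
Qed.

(** * Coordinates in an orthonormal basis and the Newton transformation *)

Section EuclideanForms.
Variables (R : realType) (V : vectType R) (n : nat) (e : n.-tuple V).

Lemma dform_of_bil_bform (b : V -> V -> R) :
  dform_of_bil e b = bform (bil_mx e b).
Proof.
by apply: eq_bigr => i _; apply: eq_bigr => j _; rewrite mxE.
Qed.

Lemma bil_mx_orthonormal (g : {dot V for idfun}) :
  orthonormal_basis e g -> bil_mx e g = 1%:M.
Proof. by case=> _ ge; apply/matrixP => i j; rewrite !mxE ge. Qed.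

Lemma ext1_basis (i : 'I_n) : basis_of fullv e -> ext1 e e`_i = emon R [set i].
Proof.
move=> be; rewrite /ext1 (bigD1 i) //= big1 ?addr0 => [|j nji].
  by rewrite coord_free ?(basis_free be) // eqxx scale1r.
by rewrite coord_free ?(basis_free be) // eq_sym (negPf nji) scale0r.
Qed.

End EuclideanForms.

Lemma deval_emon (R : comNzRingType) (n : nat) (w : dform R n) S T :
  deval w (emon R S) (emon R T) = w (S, T).
Proof.
rewrite /deval (bigD1 S) //= [X in _ + X]big1 ?addr0 => [|U /negPf nU].
  rewrite (bigD1 T) //= big1 ?addr0 => [|W /negPf nW].
    by rewrite !ffunE !eqxx !mulr1.
  by rewrite !ffunE nW mulr0.
by rewrite big1 // => W _; rewrite !ffunE nU mulr0 mul0r.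
Qed.

Lemma deval_hodge_emon (R : comNzRingType) (n : nat) (w : dform R n) S T :
  deval w (hodge (emon R S)) (hodge (emon R T)) =
    wsign R S (~: S) * wsign R T (~: T) * w (~: S, ~: T).
Proof.
rewrite -(deval_emon w) /deval mulr_sumr; apply: eq_bigr => U _.
rewrite mulr_sumr; apply: eq_bigr => W _; rewrite !emon_hodge.
by rewrite [w _ * _]mulrCA [LHS]mulrACA.
Qed.

Theorem proposition2p5 (R : realType) (V : vectType R) (n : nat)
  (hn : \dim (fullv : {vspace V}) = n)
  (g : {dot V for idfun}) (h : {bilinear V -> V -> R | *%R & *%R})
  (e : n.-tuple V) (he : orthonormal_basis e g)
  (k : nat) (hk : (k < n)%N) :
  k.+1%:R * char_inv e k.+1 h = bil_inner e (newton_transf e g k h) h.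
Proof.
have [be _] := he; set A := bil_mx e h; set j := (n - k.+1)%N.
have jn : (j <= n)%N by apply: leq_subr.
have nj : (n - j = k.+1)%N by apply: subKn.
(* As [g] has the identity matrix in the basis [e], this is the double form whose star enters
   [newton_transf]. *)
pose w : dring R n := bform 1%:M ^+ j * bform A ^+ k.
have E : bil_inner e (newton_transf e g k h) h
    = (k`! * j`!)%:R^-1 * (bform A * w) (setT, setT).
  rewrite bform_mul_top mulr_sumr; apply: eq_bigr => i _.
  rewrite mulr_sumr; apply: eq_bigr => l _.
  rewrite /newton_transf -subnDA add1n /bil_of_dform !ext1_basis // deval_emon.
  rewrite ffunE [dstar _ _]ffunE deval_hodge_emon !dform_of_bil_bform.
  rewrite (bil_mx_orthonormal he) !dpow_expr -/A -/j -/w mxE.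
  by rewrite -[LHS]mulrA; congr (_ * _); rewrite mulrC.
(* By commutativity the extra factor [bform A] joins the other [k]. *)
have Ew : bform A * w = bform A ^+ (n - j) * bform 1%:M ^+ j.
  rewrite nj exprS -mulrA; congr (_ * _).
  by apply: commrX; apply/commr_sym/commrX/bform_comm.
rewrite E Ew -coef_det_subX // nj /char_inv -/j -/A.
(* Once the normalization of [newton_transf] is cancelled, the factorial of [k.+1] leaves the factor
   [k.+1] of the claim. *)
rewrite (_ : (j`! * k.+1`!)%N = (k`! * j`! * k.+1)%N); last first.
  by rewrite factS mulnCA mulnC (mulnC j`!).
rewrite (natrM _ (k`! * j`!)) -[in RHS]mulrA mulKf //.
by rewrite pnatr_eq0 -lt0n muln_gt0 !fact_gt0.
Qed.
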